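(* Let $n\ge 1$ be an integer and let $\gamma,\upsilon$ be real numbers with $0<\upsilon<\gamma$. Let $\mathbf{O}=\{k\,2^{1-n} : k\in\mathbb{Z},\ 0\le k\le 2^{n-1}\}$ and $$\mathbf{S}^{*}=\{(R,\tilde F)\in\mathbb{R}_{+}^{2} : \tilde F\le\gamma,\ \tilde F R\le \upsilon,\ R\in\mathbf{O}\}.$$ Let $\mu^{-},\mu^{+},\delta,\epsilon$ be the parameters determined by $n,\gamma,\upsilon$ as defined in the context. Then the convex hull of $\mathbf{S}^{*}$ is $$\operatorname{conv}(\mathbf{S}^{*})=\{(R,\tilde F)\in\mathbb{R}_{+}^{2} : \tilde F\le\gamma,\ R\le 1,\ \text{and } (R,\tilde F)\text{ satisfies (A), (B), (C)}\},$$ where the constraints, each of which is imposed only when the stated condition on the parameters holds, are: (A) if $\delta\ge\epsilon$: $\ \tilde F\le \delta(R-1)+\upsilon$; (B) if $\delta<\epsilon$: $\ \tilde F\le \epsilon(R-\mu^{-})+\gamma$; (C) if $\delta<\epsilon$: $\ \tilde F\le \dfrac{\upsilon/\mu^{+}-\upsilon}{\mu^{+}-1}(R-1)+\upsilon$.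
   Context: $\mathbb{R}_{+}$ denotes the nonnegative reals. The set $\mathbf{O}=\{0,2^{1-n},2\cdot 2^{1-n},\dots,1-2^{1-n},1\}$ is the arithmetic progression from $0$ to $1$ with step $2^{1-n}$. The parameters are $$\mu^{-}=2^{1-n}\left\lfloor \frac{\upsilon}{2^{1-n}\gamma}\right\rfloor,\qquad \mu^{+}=\mu^{-}+2^{1-n},$$ $$\delta=\frac{\gamma-\upsilon}{\mu^{-}-1},\qquad \epsilon=\frac{\gamma-\upsilon/\mu^{+}}{\mu^{-}-\mu^{+}}.$$ Since $\upsilon<\gamma$, one has $\mu^{-}<1$ and $0<\mu^{+}\le 1$, so $\delta$ and $\epsilon$ are well defined. If $\mu^{+}=1$, then $\delta=\epsilon$, so constraint (C) is not imposed and no division by zero occurs. *)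

(* Defs.v *)
From mathcomp Require Import all_boot all_order all_algebra.
From mathcomp Require Import boolp classical_sets reals convex.

Set Implicit Arguments.
Unset Strict Implicit.
Unset Printing Implicit Defensive.

Import Order.TTheory GRing.Theory Num.Theory.
Local Open Scope classical_set_scope.
Local Open Scope ring_scope.

Definition convex_hull (R : numDomainType) (M : lmodType R) (A : set M) :
    set M :=
  smallest (@convex_set R M) A.

Section Hull.
Variables (R : realType) (n : nat) (gamma upsilon : R).

(* Integer (possibly negative) power of 2 in R. *)
Definition step : R := 2 ^ (1 - n%:Z).

(* The truncated exponent n - 1 is the true one as soon as n >= 1. *)
Definition grid : set R :=
  [set x | exists k : int, 0 <= k <= 2 ^+ (n - 1) /\ x = k%:~R * step].

(* Points are pairs (R, F~); the copies R^o only serve to equip the pairs with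
   their R-module structure. *)
Definition S_star : set (R^o * R^o)%type :=
  [set p | [/\ 0 <= p.1, 0 <= p.2, p.2 <= gamma, p.2 * p.1 <= upsilon
             & grid p.1]].

Definition mu_minus : R :=
  step * (Num.floor (upsilon / (step * gamma)))%:~R.

Definition mu_plus : R := mu_minus + step.

Definition delta : R := (gamma - upsilon) / (mu_minus - 1).

Definition epsilon : R :=
  (gamma - upsilon / mu_plus) / (mu_minus - mu_plus).

End Hull.

Arguments step : clear implicits.
Arguments grid : clear implicits.

(* Main.v *)
Require Import Defs.
From mathcomp Require Import all_boot all_order all_algebra.
From mathcomp Require Import boolp classical_sets reals convex.
From mathcomp Require Import interval_inference ring lra.

(** The points of S* lie on the vertical lines over the grid, where they fill
    the segments of height min(gamma, upsilon / x).  The hull is therefore the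
    region under the upper concave envelope of these heights.

    The height is gamma up to mu-, the last grid point not above
    upsilon / gamma, and upsilon / x from the next grid point mu+ on.  As x |-> upsilon / x is
    convex, the heights at grid points strictly between mu+ and 1 lie under the
    chord from mu+ to 1, whose slope is - upsilon / mu+.  So only the abscissas
    0, mu-, mu+ and 1 can carry vertices of the envelope, and the remaining
    question is whether mu+ does.  The slope delta of the chord from mu- to 1
    is the weighted mean of the slope epsilon of the chord from mu- to mu+ and
    of the slope - upsilon / mu+ of the chord from mu+ to 1
    ([slope_weighted_mean]).  Hence delta >= epsilon means that mu+ lies on or
    under the chord from mu- to 1, which is then the last edge (A), and
    delta < epsilon that the edges are the chords (B) and (C).

    One inclusion of the theorem holds because the right-hand side is convex
    ([convex_envelope_region]) and contains S* ([S_star_sub_envelope_region]).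
    For the other, a point of the right-hand side lies under one of the chords,
    and a convex set with the vertical segments over the two ends of a chord
    contains the trapezoid under it ([convex_trapezoid]). *)

Import Order.TTheory GRing.Theory Num.Theory.
Local Open Scope classical_set_scope.
Local Open Scope ring_scope.

(** * Convexity in the plane *)

Section Plane.
Variable R : realType.
Implicit Types (A : set (R^o * R^o)%type) (t s c a x y : R).

(** Unfolds membership and the bundled coefficient of the convex combination,
    so that both can be handled by field arithmetic. *)
Lemma convex_set_planeP A :
  convex_set A <->
  forall x y x' y' t, 0 <= t <= 1 -> A (x, y) -> A (x', y') ->
    A (t * x + (1 - t) * x', t * y + (1 - t) * y').
Proof.
split=> [cA x y x' y' t /andP[t0 t1] Ap Aq | cA [x y] [x' y'] l].
  exact/set_mem/(cA (x, y) (x', y') (Itv01 t0 t1) (mem_set Ap) (mem_set Aq)).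
by move=> /set_mem Ap /set_mem Aq; apply/mem_set/cA; rewrite // ge0 le1.
Qed.

Lemma comb_under_line s a c x y x' y' t : 0 <= t <= 1 ->
  y <= s * (x - a) + c -> y' <= s * (x' - a) + c ->
  t * y + (1 - t) * y' <= s * (t * x + (1 - t) * x' - a) + c.
Proof. by move=> t01 h h'; nra. Qed.

(** The point (x, y) is reached by lowering both ends of the chord by the same
    factor y / h, where h is the height of the chord over x. *)
Lemma convex_trapezoid A a ya b yb x y :
  convex_set A -> a < b ->
  (forall z, 0 <= z <= ya -> A (a, z)) ->
  (forall z, 0 <= z <= yb -> A (b, z)) ->
  0 <= ya -> 0 <= yb -> a <= x <= b -> 0 <= y ->
  y * (b - a) <= ya * (b - x) + yb * (x - a) -> A (x, y).
Proof.
move=> /convex_set_planeP cA ab Aa Ab ya0 yb0 /andP[ax xb] y0 yle.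
have ba0 : 0 < b - a by rewrite subr_gt0.
pose t := (b - x) / (b - a).
have t0 : 0 <= t by rewrite divr_ge0 ?subr_ge0 // ltW.
have t1 : t <= 1 by rewrite ler_pdivrMr //; lra.
have Et : t * (b - a) = b - x by rewrite divfK // gt_eqF.
pose h := t * ya + (1 - t) * yb.
have yh : y <= h by rewrite -(ler_pM2r ba0) /h; nra.
have [r [r0 r1 Er]] : exists r, [/\ 0 <= r, r <= 1 & r * h = y].
  have h0 : 0 <= h by exact: le_trans yh.
  have [hz|hnz] := eqVneq h 0; first by exists 0; split=> //; lra.
  exists (y / h); rewrite divfK // divr_ge0 // ler_pdivrMr ?mul1r //.
  by rewrite lt0r hnz.
have -> : x = t * a + (1 - t) * b by nra.
have -> : y = t * (r * ya) + (1 - t) * (r * yb) by rewrite -Er /h; ring.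
by apply: cA; rewrite ?t0 //; [apply: Aa | apply: Ab]; nra.
Qed.

End Plane.

(** * The grid points around upsilon / gamma *)

Section Grid.
Context (R : realType) (n : nat) (gamma upsilon : R).
Hypotheses (n_ge1 : (1 <= n)%N) (upsilon_gt0 : 0 < upsilon)
  (upsilon_lt_gamma : upsilon < gamma).

Let mum := mu_minus n gamma upsilon.
Let mup := mu_plus n gamma upsilon.
Let m := Num.floor (upsilon / (step R n * gamma)).
Let N : int := 2 ^+ (n - 1).

Let gamma_gt0 : 0 < gamma. Proof. exact: lt_trans upsilon_lt_gamma. Qed.

Lemma step_gt0 : 0 < step R n.
Proof. by rewrite exprz_gt0. Qed.

Lemma step_subdivides1 : (2 ^+ (n - 1) : int)%:~R * step R n = 1.
Proof.
rewrite rmorphXn /= /step.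
have -> : 1 - n%:Z = - (n - 1)%N%:Z by rewrite -subzn //; ring.
by rewrite -exprnN mulfV // expf_neq0.
Qed.

Let mumE : mum = m%:~R * step R n. Proof. by rewrite mulrC. Qed.

Let mupE : mup = (m + 1)%:~R * step R n.
Proof. by rewrite intrD mulrDl mul1r -mumE. Qed.

Lemma mu_minus_mul_gamma : mum * gamma <= upsilon.
Proof.
have := floor_le (upsilon / (step R n * gamma)).
by rewrite ler_pdivlMr ?mulr_gt0 ?step_gt0 // mulrA -mumE.
Qed.

Lemma mu_plus_mul_gamma : upsilon < mup * gamma.
Proof.
have := floorD1_gt (upsilon / (step R n * gamma)).
by rewrite ltr_pdivrMr ?mulr_gt0 ?step_gt0 // mulrA -mupE.
Qed.

Lemma mu_minus_lt_plus : mum < mup.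
Proof. by rewrite ltrDl step_gt0. Qed.

Lemma mu_minus_ge0 : 0 <= mum.
Proof.
by rewrite mumE mulr_ge0 ?(ltW step_gt0) // ler0z floor_ge0 divr_ge0 ?ltW //
   mulr_gt0 // step_gt0.
Qed.

Lemma mu_minus_lt1 : mum < 1.
Proof.
by rewrite -(ltr_pM2r gamma_gt0) mul1r (le_lt_trans mu_minus_mul_gamma).
Qed.

Let m_ltN : m < N.
Proof.
rewrite -(ltr_int R) -(ltr_pM2r step_gt0) step_subdivides1 -mumE.
exact: mu_minus_lt1.
Qed.

Lemma mu_plus_le1 : mup <= 1.
Proof.
by rewrite -step_subdivides1 mupE ler_pM2r ?step_gt0 // ler_int lezD1 m_ltN.
Qed.

Lemma grid0 : grid R n 0.
Proof. by exists 0; rewrite mul0r exprn_ge0. Qed.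

Lemma grid1 : grid R n 1.
Proof. by exists N; rewrite step_subdivides1 exprn_ge0 /=. Qed.

Let m_ge0 : 0 <= m.
Proof. by rewrite floor_ge0 divr_ge0 ?ltW // mulr_gt0 // step_gt0. Qed.

Lemma grid_mu_minus : grid R n mum.
Proof. by exists m; rewrite mumE m_ge0 ltW // m_ltN. Qed.

Lemma grid_mu_plus : grid R n mup.
Proof. by exists (m + 1); rewrite mupE addr_ge0 //= lezD1 m_ltN. Qed.

Lemma grid_le1 x : grid R n x -> x <= 1.
Proof.
move=> [k [/andP[_ kN] ->]].
by rewrite -[leRHS]step_subdivides1 ler_pM2r ?step_gt0 // ler_int.
Qed.

Lemma grid_gap x : grid R n x -> x <= mum \/ mup <= x.
Proof.
move=> [k [_ ->]]; rewrite mumE mupE !(ler_pM2r step_gt0) !ler_int lezD1.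
by case: (leP k m); [left | right].
Qed.

(** * The edges of the envelope *)

Let del := delta n gamma upsilon.
Let eps := epsilon n gamma upsilon.
Let q := upsilon / mup.

Let mup_gt0 : 0 < mup.
Proof. exact: le_lt_trans mu_minus_ge0 mu_minus_lt_plus. Qed.

Let mup_q : q * mup = upsilon.
Proof. by rewrite divfK // gt_eqF. Qed.

Lemma delta_mul : del * (1 - mum) = upsilon - gamma.
Proof.
by rewrite /del /delta -/mum; field; rewrite lt_eqF // subr_lt0 mu_minus_lt1.
Qed.

Lemma epsilon_mul : eps * (mup - mum) = q - gamma.
Proof.
rewrite /eps /epsilon -/mum -/mup -/q; field.
by rewrite lt_eqF // subr_lt0 mu_minus_lt_plus.
Qed.

Lemma delta_lt0 : del < 0.
Proof.
have mum1 : 0 < 1 - mum by rewrite subr_gt0 mu_minus_lt1.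
by rewrite -(pmulr_llt0 _ mum1) delta_mul subr_lt0.
Qed.

Lemma epsilon_lt0 : eps < 0.
Proof.
have mupm : 0 < mup - mum by rewrite subr_gt0 mu_minus_lt_plus.
rewrite -(pmulr_llt0 _ mupm) epsilon_mul subr_lt0 ltr_pdivrMr //.
by rewrite mulrC mu_plus_mul_gamma.
Qed.

(** The rise from mu- to 1 is the sum of the rises from mu- to mu+ and from mu+
    to 1.  In product form this also covers mu+ = 1, where the last chord
    degenerates. *)
Lemma slope_weighted_mean :
  (1 - mum) * del = (mup - mum) * eps + (1 - mup) * - q.
Proof. by have := delta_mul; have := epsilon_mul; have := mup_q; lra. Qed.

Lemma last_slopeE : mup < 1 -> (upsilon / mup - upsilon) / (mup - 1) = - q.
Proof.
move=> mup1; rewrite -/q; apply: (canLR (mulfK _)); last first.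
  by have := mup_q; lra.
by rewrite lt_eqF // subr_lt0.
Qed.

(** When mu+ = 1 the two chords starting over mu- coincide. *)
Lemma mu_plus_lt1 : del < eps -> mup < 1.
Proof.
move=> lt_de; rewrite lt_neqAle mu_plus_le1 andbT.
apply: contraTneq lt_de => mup1; rewrite -leNgt.
have := slope_weighted_mean; rewrite mup1 subrr mul0r addr0.
by move/(mulfI _) => -> //; rewrite gt_eqF // subr_gt0 mu_minus_lt1.
Qed.

(** A weighted mean that is less than one of its terms exceeds the other; the
    next lemma is the opposite case. *)
Lemma last_slope_lt_delta : del < eps -> - q < del.
Proof.
move=> de; have mup1 := mu_plus_lt1 de.
have mup1' : 0 < 1 - mup by rewrite subr_gt0.
have mupm : 0 < mup - mum by rewrite subr_gt0 mu_minus_lt_plus.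
have de' : del * (mup - mum) < eps * (mup - mum) by rewrite ltr_pM2r.
by rewrite -(ltr_pM2r mup1'); have := slope_weighted_mean; lra.
Qed.

Lemma delta_le_last_slope : mup < 1 -> eps <= del -> del <= - q.
Proof.
move=> mup1 ed; have mup1' : 0 < 1 - mup by rewrite subr_gt0.
have mupm : 0 < mup - mum by rewrite subr_gt0 mu_minus_lt_plus.
rewrite -(ler_pM2r mup1').
by have := slope_weighted_mean; have := ler_wpM2r (ltW mupm) ed; lra.
Qed.

Definition envelope_region : set (R^o * R^o)%type :=
  [set p : (R^o * R^o)%type |
    [/\ 0 <= p.1, 0 <= p.2, p.2 <= gamma & p.1 <= 1] /\
    [/\ del >= eps -> p.2 <= del * (p.1 - 1) + upsilon,
        del < eps -> p.2 <= eps * (p.1 - mum) + gamma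
      & del < eps ->
          p.2 <= (upsilon / mup - upsilon) / (mup - 1) * (p.1 - 1) + upsilon]].

Lemma convex_envelope_region : convex_set envelope_region.
Proof.
apply/convex_set_planeP => x y x' y' t t01.
move=> [[/= x0 y0 yg x1] [hA hB hC]] [[/= x0' y0' yg' x1'] [hA' hB' hC']].
split; first by split=> /=; nra.
by split=> /= h; apply: comb_under_line; auto.
Qed.

(** The secant bound for the convex function x |-> upsilon / x on [mu+, 1]. *)
Lemma under_last_chord x y : mup <= x -> x <= 1 -> y * x <= upsilon ->
  y <= - q * (x - 1) + upsilon.
Proof.
move=> mupx x1 yx; have x0 := lt_le_trans mup_gt0 mupx.
have q0 : 0 < q by rewrite divr_gt0.
rewrite -(ler_pM2r x0) (le_trans yx) // -subr_ge0.
have -> : (- q * (x - 1) + upsilon) * x - upsilon = q * (x - mup) * (1 - x).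
  by rewrite -mup_q; ring.
by apply: mulr_ge0; [apply: mulr_ge0; [exact: ltW|] |]; rewrite subr_ge0.
Qed.

Lemma S_star_sub_envelope_region : S_star n gamma upsilon `<=` envelope_region.
Proof.
suff in_region (x y : R) :
    S_star n gamma upsilon (x, y) -> envelope_region (x, y).
  by move=> [x y]; exact: in_region.
move=> [/= x0 y0 yg yx gx]; have x1 := grid_le1 _ gx.
have x1' : 0 <= 1 - x by rewrite subr_ge0.
split=> //=.
have eqd := delta_mul.
have del_xm := ler_wnM2l (ltW delta_lt0).
have eps_xm := ler_wnM2l (ltW epsilon_lt0).
have [xm|xp] := grid_gap _ gx.
  split=> [_|_|de].
  - by have := del_xm _ _ xm; lra.
  - by have := eps_xm _ _ xm; lra.
  - rewrite last_slopeE ?mu_plus_lt1 //.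
    (* The line (C) is steeper than the chord from mu- to 1 and meets it at 1,
       so it lies above that chord, which is at least gamma up to mu-. *)
    have := ler_wpM2r x1' (ltW (last_slope_lt_delta de)).
    by have := del_xm _ _ xm; lra.
have yC := under_last_chord _ _ xp x1 yx.
split=> [ed|de|de].
- have [mup1|] := ltP mup 1; last first.
    (* For mu+ = 1 the mean says nothing about - q, but then x = 1. *)
    by move=> mup1; move: yC; have -> : x = 1; lra.
  by have := ler_wpM2r x1' (delta_le_last_slope mup1 ed); lra.
- (* Lines (B) and (C) cross at mu+; beyond it (B), less steep, is above. *)
  have xp' : 0 <= x - mup by rewrite subr_ge0.
  have := ler_wpM2r xp' (ltW (lt_trans (last_slope_lt_delta de) de)).
  by have := mup_q; have := epsilon_mul; lra.
- by rewrite last_slopeE // mu_plus_lt1.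
Qed.

(** Up to mu-, the bound upsilon on the product follows from height gamma. *)
Lemma S_star_mu_minus x y : grid R n x -> 0 <= x <= mum -> 0 <= y <= gamma ->
  S_star n gamma upsilon (x, y).
Proof.
move=> gx /andP[x0 xm] /andP[y0 yg]; split=> //=.
by have := mu_minus_mul_gamma; nra.
Qed.

(** From mu+ on, the bound gamma on the height follows from upsilon / x. *)
Lemma S_star_mu_plus x y : grid R n x -> mup <= x -> 0 <= y <= upsilon / x ->
  S_star n gamma upsilon (x, y).
Proof.
move=> gx mupx /andP[y0]; have x0 := lt_le_trans mup_gt0 mupx.
rewrite ler_pdivlMr // => yx; split=> //=; first exact: ltW.
rewrite -(ler_pM2r x0) (le_trans yx) // (le_trans (ltW mu_plus_mul_gamma)) //.
by rewrite mulrC ler_pM2l.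
Qed.

Lemma envelope_region_sub_convex A : convex_set A ->
  S_star n gamma upsilon `<=` A -> envelope_region `<=` A.
Proof.
move=> cA SA.
suff in_A (x y : R) : envelope_region (x, y) -> A (x, y).
  by move=> [x y]; exact: in_A.
move=> [[/= x0 y0 yg x1] [hA hB hC]].
have m0 := mu_minus_ge0; have lt1 := mu_minus_lt1; have ltp := mu_minus_lt_plus.
have q0 : 0 <= q by rewrite divr_ge0 ?ltW.
have Amum z : 0 <= z <= gamma -> A (mum, z).
  move=> ?; apply/SA/S_star_mu_minus; rewrite ?m0 ?lexx //.
  exact: grid_mu_minus.
have Amup z : 0 <= z <= q -> A (mup, z).
  by move=> ?; apply/SA/S_star_mu_plus => //; apply: grid_mu_plus.
have A1 z : 0 <= z <= upsilon -> A (1, z).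
  move=> ?; apply/SA/S_star_mu_plus; rewrite ?divr1 ?mu_plus_le1 //.
  exact: grid1.
have [xm|mx] := leP x mum.
  have [mum0|mum_neq0] := eqVneq mum 0.
    (* The chord from 0 to mu- degenerates to a vertical segment. *)
    by have -> : x = mum by [lra]; apply: Amum; rewrite y0.
  apply: (@convex_trapezoid _ A 0 gamma mum gamma);
    rewrite ?x0 ?(ltW gamma_gt0) //.
  - by rewrite lt0r mum_neq0.
  - by move=> z z0g; apply/SA/S_star_mu_minus; rewrite ?lexx //; apply: grid0.
  - by nra.
have [ed|de] := leP eps del.
  apply: (@convex_trapezoid _ A mum gamma 1 upsilon);
    rewrite ?(ltW mx) ?(ltW gamma_gt0) ?(ltW upsilon_gt0) //.
  by have := hA ed; have := delta_mul; nra.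
have mup1 := mu_plus_lt1 de.
have [xp|px] := leP x mup.
  apply: (@convex_trapezoid _ A mum gamma mup q);
    rewrite ?(ltW mx) ?(ltW gamma_gt0) //.
  by have := hB de; have := epsilon_mul; nra.
apply: (@convex_trapezoid _ A mup q 1 upsilon);
    rewrite ?(ltW px) ?(ltW upsilon_gt0) //.
by have := hC de; rewrite last_slopeE //; have := mup_q; nra.
Qed.

End Grid.

Theorem proposition1 (R : realType) (n : nat) (gamma upsilon : R)
    (n_ge1 : (1 <= n)%N) (upsilon_gt0 : 0 < upsilon)
    (upsilon_lt_gamma : upsilon < gamma) :
  let mum := mu_minus n gamma upsilon in
  let mup := mu_plus n gamma upsilon in
  let del := delta n gamma upsilon in
  let eps := epsilon n gamma upsilon in
  convex_hull (S_star n gamma upsilon) =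
  [set p : (R^o * R^o)%type |
    [/\ 0 <= p.1, 0 <= p.2, p.2 <= gamma & p.1 <= 1] /\
    [/\ del >= eps -> p.2 <= del * (p.1 - 1) + upsilon,
        del < eps -> p.2 <= eps * (p.1 - mum) + gamma
      & del < eps ->
          p.2 <= (upsilon / mup - upsilon) / (mup - 1) * (p.1 - 1) + upsilon]].
Proof.
move=> mum mup del eps; apply/seteqP; split.
  apply: smallest_sub; first exact: convex_envelope_region.
  exact: S_star_sub_envelope_region.
by move=> p p_in A [cA SA]; apply: envelope_region_sub_convex p_in.
Qed.
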